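(* Consider the setting, standing assumptions and BPGe iteration described in the context. Suppose $\rho<\underline{\lambda}/\overline{\lambda}$ and let $\{x^k\}_{k\in\mathbb{N}}$ be a sequence generated from $x^0$ by BPGe. Then: (i) $\sum_{k=0}^{\infty}D_h(x^{k-1},x^k)<\infty$ and $\lim_{k\to\infty}D_h(x^{k-1},x^k)=0$. (ii) Any limit point of $\{x^k\}_{k\in\mathbb{N}}$ is a critical point of $\Psi$, i.e. $\omega(x^0)\subseteq\operatorname{crit}\Psi$. (iii) $\zeta:=\lim_{k\to\infty}\Psi(x^k)$ exists and $\Psi\equiv\zeta$ on $\omega(x^0)$.
   Context: **Problem.** $\Psi=f+g$ on $\mathbb{R}^d$, where $f:\mathbb{R}^d\to\mathbb{R}$ is continuously differentiable (possibly nonconvex), $g:\mathbb{R}^d\to(-\infty,+\infty]$ is proper, lower semicontinuous and convex, and $\inf\Psi>-\infty$. **Kernel and Bregman distance.** $h\in\mathcal{G}(\mathbb{R}^d)$, i.e. $h$ is convex and $C^1$ on $\mathbb{R}^d$ (so $\operatorname{dom}h=\operatorname{int}\operatorname{dom}h=\mathbb{R}^d$). $D_h(x,y)=h(x)-h(y)-\langle\nabla h(y),x-y\rangle$. **Standing assumptions.** - $(f,h)$ is $L$-smooth adaptable: $L>0$ and both $Lh-f$ and $Lh+f$ are convex on $\mathbb{R}^d$. - $f$ is $\mu$-weakly convex relative to $h$: $f+\mu h$ is convex on $\mathbb{R}^d$, where $0\le\mu\le L$ ($\mu=0$ being used when $f$ is convex). - $\Psi$ is supercoercive: $\lim_{\|u\|\to\infty}\Psi(u)/\|u\|=\infty$.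 - $h$ is strictly convex; if $x^k\to x\in\operatorname{dom}h$ then $D_h(x,x^k)\to0$; if $y^k\to x^*$, $\{x^k\}$ is bounded and $D_h(x^k,y^k)\to0$, then $x^k\to x^*$ (here $\{x^k\},\{y^k\}$ are arbitrary sequences in $\operatorname{dom} h$). **BPGe.** Fix $0<\eta<1$, $\hat\beta\in[0,1)$, $0<\rho<1$, and step sizes $0<\lambda_k\le1/L$ ($k\in\mathbb{N}=\{0,1,2,\dots\}$) with $\underline{\lambda}:=\inf_k\lambda_k>0$, $\overline{\lambda}:=\sup_k\lambda_k$. Put $C_k=\lambda_k^{-1}/(\lambda_k^{-1}+\mu)$. Start from $x^{-1}=x^0\in\operatorname{int}\operatorname{dom}h=\mathbb{R}^d$. For $k=0,1,2,\dots$: let $\beta_k=\eta^j\hat\beta$ with $j\ge0$ the smallest integer such that $D_h(x^k,x^k+\eta^j\hat\beta(x^k-x^{k-1}))\le\rho\,C_k\,D_h(x^{k-1},x^k)$; set $y^k=x^k+\beta_k(x^k-x^{k-1})$ and choose $$x^{k+1}\in\arg\min_{x\in\mathbb{R}^d}\Big\{g(x)+\langle x-y^k,\nabla f(y^k)\rangle+\tfrac1{\lambda_k}D_h(x,y^k)\Big\}.$$ The iteration runs indefinitely (no stopping test). **Notation.** $\omega(x^0)$ is the set of all limit points (limits of convergent subsequences) of $\{x^k\}_{k\in\mathbb{N}}$. $\operatorname{crit}\Psi=\{x:0\in\partial\Psi(x)\}$, with $\partial$ the limiting subdifferential (here $\partial\Psi=\nabla f+\partial g$). *)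

(* Defs.v *)
(* MathComp-Analysis; R^d is rendered as 'rV[R]_d with R : realType. *)
From HB Require Import structures.
From mathcomp Require Import all_boot all_order all_algebra.
From mathcomp Require Import all_classical all_reals all_analysis.
Set Implicit Arguments.
Unset Strict Implicit.
Unset Printing Implicit Defensive.
Import Order.TTheory GRing.Theory Num.Theory.
Import numFieldNormedType.Exports.
Local Open Scope classical_set_scope.
Local Open Scope ring_scope.

Section euclidean.
Context {R : realType} {d : nat}.
Implicit Types (u v x y : 'rV[R]_d) (f h : 'rV[R]_d -> R).

Definition dotv u v : R := \sum_(i < d) u 0 i * v 0 i.

(* The library norm on 'rV[R]_d is the max-norm; it induces the same topology. *)
Definition enorm u : R := Num.sqrt (dotv u u).

Definition grad f x : 'rV[R]_d := \row_(i < d) 'D_(delta_mx 0 i) f x.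

Definition continuously_differentiable f : Prop :=
  (forall x, differentiable f x) /\ continuous (grad f).

Definition convex_on_space f : Prop := convex_function setT f.

Definition strictly_convex f : Prop :=
  forall x y (t : R), x != y -> 0 < t -> t < 1 ->
    f (t *: x + (1 - t) *: y) < t * f x + (1 - t) * f y.

Definition bregman h x y : R := h x - h y - dotv (grad h y) (x - y).

Definition kernel_generating h : Prop :=
  convex_on_space h /\ continuously_differentiable h.

Definition smooth_adaptable f h (L : R) : Prop :=
  [/\ 0 < L,
      convex_on_space (fun u => L * h u - f u) &
      convex_on_space (fun u => L * h u + f u)].

Definition relatively_weakly_convex f h (mu : R) : Prop :=
  convex_on_space (fun u => f u + mu * h u).

End euclidean.

Section extended_valued.
Context {R : realType} {d : nat}.
Implicit Types (u v x y : 'rV[R]_d) (phi : 'rV[R]_d -> \bar R).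
Local Open Scope ereal_scope.

Definition eproper phi : Prop :=
  (forall x, phi x != -oo) /\ (exists x, phi x < +oo).

(* Meant for functions that never take the value -oo; recall 0 * +oo = 0. *)
Definition econvex phi : Prop :=
  forall x y (t : R), (0 <= t)%R -> (t <= 1)%R ->
    phi (t *: x + (1 - t) *: y)%R <= t%:E * phi x + (1 - t)%:E * phi y.

(* phi(u) / |u| --> +oo as |u| --> +oo *)
Definition supercoercive phi : Prop :=
  forall A : R, exists r : R, forall u,
    (r < enorm u)%R -> A%:E <= phi u * ((enorm u)^-1)%:E.

Definition argmin phi : set 'rV[R]_d := [set x | forall u, phi x <= phi u].

Definition frechet_subdiff phi x : set 'rV[R]_d :=
  [set v | phi x \is a fin_num /\
    0 <= limf_einf
      (fun y => (phi y - phi x - (dotv v (y - x))%:E) * ((enorm (y - x))^-1)%:E)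
      (x^')].

Definition limiting_subdiff phi x : set 'rV[R]_d :=
  [set v | phi x \is a fin_num /\
    exists (xs vs : nat -> 'rV[R]_d),
      [/\ xs n @[n --> \oo] --> x,
          phi (xs n) @[n --> \oo] --> phi x,
          forall n, frechet_subdiff phi (xs n) (vs n) &
          vs n @[n --> \oo] --> v]].

Definition crit phi : set 'rV[R]_d := [set x | limiting_subdiff phi x 0%R].

End extended_valued.

Section bpge.
Context {R : realType} {d : nat}.
Implicit Types (x y : 'rV[R]_d) (f h : 'rV[R]_d -> R) (g : 'rV[R]_d -> \bar R).

Definition objective f g x : \bar R := ((f x)%:E + g x)%E.

Definition bpg_model f g h (lambda : R) y x : \bar R :=
  (g x + (dotv (x - y) (grad f y) + lambda^-1 * bregman h x y)%:E)%E.

Definition extrapolate (beta : R) xprev x : 'rV[R]_d := x + beta *: (x - xprev).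

Definition linesearch_ok h (mu eta betahat rho lambda : R) xprev x (j : nat) :=
  bregman h x (extrapolate (eta ^+ j * betahat) xprev x)
    <= rho * (lambda^-1 / (lambda^-1 + mu)) * bregman h xprev x.

(* The iterate x^{k-1} is [x k.-1]: since 0.-1 = 0, this includes x^{-1} = x^0. *)
Definition bpge f g h (mu eta betahat rho : R) (lambda : nat -> R)
    (x0 : 'rV[R]_d) (x : nat -> 'rV[R]_d) : Prop :=
  x 0%N = x0 /\
  forall k : nat, exists j : nat,
    let ok := linesearch_ok h mu eta betahat rho (lambda k) (x k.-1) (x k) in
    let y := extrapolate (eta ^+ j * betahat) (x k.-1) (x k) in
    [/\ ok j,
        forall i : nat, (i < j)%N -> ~~ ok i &
        argmin (bpg_model f g h (lambda k) y) (x k.+1)].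

Definition omega_limit (x : nat -> 'rV[R]_d) : set 'rV[R]_d :=
  [set z | exists2 s : nat -> nat, increasing_seq s & x (s n) @[n --> \oo] --> z].

End bpge.

(* Main.v *)
Require Import Defs.
From HB Require Import structures.
From mathcomp Require Import all_boot all_order all_algebra.
From mathcomp Require Import all_classical all_reals all_analysis.
From mathcomp Require Import lra.
Set Implicit Arguments.
Unset Strict Implicit.
Unset Printing Implicit Defensive.
Import Order.TTheory GRing.Theory Num.Theory.
Import numFieldNormedType.Exports.
Local Open Scope classical_set_scope.
Local Open Scope ring_scope.

(* The three-point inequality for the minimizer [x^{k+1}], combined with the gradient
   inequalities of [L h - f] and [f + mu h], gives for every [u]
     Psi(x^{k+1}) + D_h(u, x^{k+1}) / lambda_k
       <= Psi(u) + (1 / lambda_k + mu) D_h(u, y^k).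
   At [u = x^k] the line search bounds the last term by
   [rho / lambda_k * D_h(x^{k-1}, x^k)], so that [Psi(x^k) + D_h(x^{k-1}, x^k) / sup lambda]
   decreases by at least [(1 / sup lambda - rho / inf lambda) D_h(x^{k-1}, x^k)]; this yields
   (i) and the limit [zeta]. The value [Psi(x^0)] may be [+oo], so the argument starts at [k = 1].
   If [x^{k+1}] tends to [z] along a subsequence, so do [x^k], [x^{k-1}] and [y^k], and the
   inclusion
     - grad f(y^k) - (grad h(x^{k+1}) - grad h(y^k)) / lambda_k \in \partial g(x^{k+1})
   passes to the limit: lower semicontinuity of [g] gives [Psi(z) <= zeta], and the
   subgradient inequality at [z] gives the reverse. *)

(** * Inner product, directional derivatives and the gradient inequality *)

Section euclidean_space.
Context {R : realType} {d : nat}.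
Implicit Types (u v w x y z : 'rV[R]_d) (F f h : 'rV[R]_d -> R).

Lemma dotvC u v : dotv u v = dotv v u.
Proof. by apply: eq_bigr => i _; rewrite mulrC. Qed.

Lemma dotvDr w u v : dotv w (u + v) = dotv w u + dotv w v.
Proof. by rewrite -big_split; apply: eq_bigr => i _; rewrite mxE mulrDr. Qed.

Lemma dotvZr w (a : R) u : dotv w (a *: u) = a * dotv w u.
Proof. by rewrite /dotv mulr_sumr; apply: eq_bigr => i _; rewrite mxE mulrCA. Qed.

Lemma dotvBr w u v : dotv w (u - v) = dotv w u - dotv w v.
Proof. by rewrite dotvDr -scaleN1r dotvZr mulN1r. Qed.

Lemma dotvBl w u v : dotv (u - v) w = dotv u w - dotv v w.
Proof. by rewrite dotvC dotvBr !(dotvC w). Qed.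

Lemma dotvZl w (a : R) u : dotv (a *: u) w = a * dotv u w.
Proof. by rewrite dotvC dotvZr dotvC. Qed.

Lemma dotvNl w u : dotv (- u) w = - dotv u w.
Proof. by rewrite -scaleN1r dotvZl mulN1r. Qed.

Lemma dotv0r u : dotv u 0 = 0.
Proof. by rewrite -(scale0r 0) dotvZr mul0r. Qed.

Lemma cvg_coord (u : nat -> 'rV[R]_d) (a : 'rV[R]_d) i :
  u n @[n --> \oo] --> a -> u n 0 i @[n --> \oo] --> a 0 i.
Proof. exact: continuous_cvg (@coord_continuous _ _ _ _ _ a). Qed.

Lemma cvg_dotv (u v : nat -> 'rV[R]_d) (a b : 'rV[R]_d) :
  u n @[n --> \oo] --> a -> v n @[n --> \oo] --> b ->
  dotv (u n) (v n) @[n --> \oo] --> dotv a b.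
Proof.
move=> ua vb; rewrite /dotv; apply: cvg_big => [|i _]; first exact: add_continuous.
by apply: cvgM; [exact: cvg_coord ua | exact: cvg_coord vb].
Qed.

(** The max-norm is attained at a coordinate, whose square is one of the nonnegative terms of
    [dotv u u]. *)
Lemma norm_le_enorm u : `|u| <= enorm u.
Proof.
change (mx_norm u <= enorm u).
have [->|/mx_norm_neq0[[i j] ->]] := eqVneq (mx_norm u) 0; first exact: sqrtr_ge0.
rewrite [i]ord1 /= -sqrtr_sqr ler_wsqrtr // /dotv (bigD1 j) //= -expr2 lerDl.
by apply: sumr_ge0 => k _; rewrite -expr2 sqr_ge0.
Qed.

Lemma diff_dotv_grad F x v : differentiable F x -> 'd F x v = dotv (grad F x) v.
Proof.
move=> dF; rewrite {1}(row_sum_delta v) linear_sum; apply: eq_bigr => i _.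
by rewrite linearZ /= mxE deriveE // mulrC.
Qed.

Lemma is_derive_grad F x v :
  differentiable F x -> is_derive x v F (dotv (grad F x) v).
Proof.
move=> dF; rewrite -diff_dotv_grad // -deriveE //.
exact/derivableP/diff_derivable.
Qed.

(** Convexity is exploited at [t] in (0, 1), hence the one-sided limit. *)
Lemma is_derive_right_quotient F x v (l : R) : is_derive x v F l ->
  (F (x + t *: v) - F x) / t @[t --> 0^'+] --> l.
Proof.
move=> [dF <-].
have := dF; rewrite /derivable => /cvg_ex[l' l'P].
have -> : 'D_v F x = l' by rewrite /derive; apply: cvg_lim l'P.
have : (F (x + t *: v) - F x) / t @[t --> 0^'] --> l'.
  apply: cvg_trans l'P; apply: near_eq_cvg; near=> t => /=.
  by rewrite [_ *: _]mulrC [_ + x]addrC.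
exact: cvg_dnbhs_at_right.
Unshelve. all: by end_near. Qed.

Lemma convex_on_spaceW F x y (t : R) : convex_on_space F -> 0 <= t -> t <= 1 ->
  F (t *: x + (1 - t) *: y) <= t * F x + (1 - t) * F y.
Proof.
by move=> cF t0 t1; have := cF (Itv01 t0 t1) x y; rewrite !in_setT => /(_ isT isT).
Qed.

(** Convexity bounds the difference quotient along [v] by [F (x + v) - F x] for [t] in (0, 1); then
    [t] tends to 0+. *)
Lemma convex_derive_le F x v (l : R) :
  convex_on_space F -> is_derive x v F l -> F x + l <= F (x + v).
Proof.
move=> cF /is_derive_right_quotient; rewrite -lerBrDl => FL.
apply: (cvgr_to_le FL); near=> t.
have t0 : 0 < t by near: t; exact: nbhs_right_gt.
have t1 : t < 1 by near: t; exact: nbhs_right_lt.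
have := convex_on_spaceW (x + v) x cF (ltW t0) (ltW t1).
rewrite (_ : t *: (x + v) + _ = x + t *: v); last first.
  by rewrite scalerDr scalerBl scale1r addrC addrA subrK.
by rewrite ler_pdivrMr //; lra.
Unshelve. all: by end_near. Qed.

End euclidean_space.

(** * The model subproblem and the descent inequality *)

Section descent.
Context {R : realType} {d : nat}.
Implicit Types (u v w x y z : 'rV[R]_d) (F f h : 'rV[R]_d -> R).
Implicit Types (g : 'rV[R]_d -> \bar R).

Lemma bregman_ge0 h x y : kernel_generating h -> 0 <= bregman h x y.
Proof.
move=> [ch [dh _]]; have := convex_derive_le ch (is_derive_grad (x - y) (dh y)).
by rewrite subrKC /bregman; lra.
Qed.

Lemma smooth_adaptable_le f h (L : R) x y :
  continuously_differentiable f -> kernel_generating h ->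
  smooth_adaptable f h L ->
  f x <= f y + dotv (grad f y) (x - y) + L * bregman h x y.
Proof.
move=> [df _] [_ [dh _]] [_ cLhf _].
have D : is_derive y (x - y) (fun u => L * h u - f u)
    (L * dotv (grad h y) (x - y) - dotv (grad f y) (x - y)).
  exact: is_deriveB (is_deriveZ L (is_derive_grad _ (dh y))) (is_derive_grad _ (df y)).
by have := convex_derive_le cLhf D; rewrite subrKC /bregman; lra.
Qed.

Lemma relatively_weakly_convex_le f h (mu : R) x y :
  continuously_differentiable f -> kernel_generating h ->
  relatively_weakly_convex f h mu ->
  f y + dotv (grad f y) (x - y) - mu * bregman h x y <= f x.
Proof.
move=> [df _] [_ [dh _]] cfh.
have D : is_derive y (x - y) (fun u => f u + mu * h u)
    (dotv (grad f y) (x - y) + mu * dotv (grad h y) (x - y)).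
  exact: is_deriveD (is_derive_grad _ (df y)) (is_deriveZ mu (is_derive_grad _ (dh y))).
by have := convex_derive_le cfh D; rewrite subrKC /bregman; lra.
Qed.

Lemma argmin_model_fin_num f g h (lam : R) y xp :
  eproper g -> argmin (bpg_model f g h lam y) xp -> g xp \is a fin_num.
Proof.
move=> [gNoo [u gu]] /(_ u); rewrite fin_numE gNoo /=; apply: contraTneq => gxp.
rewrite -ltNge /bpg_model gxp addye // ltey.
by have := gNoo u; case: (g u) gu.
Qed.

(** Minimality is tested along the segment from [xp] to [u], where convexity bounds [g]; dividing by
    [t] and letting [t] tend to 0+ turns the quotient of [h] into its directional derivative. *)
Lemma argmin_model_subgradient f g h (lam : R) y xp u (gp gu : R) :
  econvex g -> kernel_generating h ->
  argmin (bpg_model f g h lam y) xp -> g xp = gp%:E -> g u = gu%:E ->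
  gp + dotv (- grad f y - lam^-1 *: (grad h xp - grad h y)) (u - xp) <= gu.
Proof.
move=> cg [_ [dh _]] min_xp gxp guE.
have FL := is_derive_right_quotient (is_derive_grad (u - xp) (dh xp)).
move: FL guE; rewrite -[in g _](subrKC xp u); move: (u - xp) => {u} w.
set q := (X in X @ _ --> _) => FL guE.
have : dotv (grad f y) w + lam^-1 * (q t - dotv (grad h y) w) @[t --> 0^'+] -->
    dotv (grad f y) w + lam^-1 * (dotv (grad h xp) w - dotv (grad h y) w).
  by apply: cvgD; [exact: cvg_cst|apply: cvgMr; apply: cvgB => //; exact: cvg_cst].
move=> /cvgr_to_ge lim_ge.
suff : gp - gu <= dotv (grad f y) w
    + lam^-1 * (dotv (grad h xp) w - dotv (grad h y) w).
  by rewrite dotvBl dotvNl dotvZl dotvBl; lra.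
apply: lim_ge; near=> t.
have t0 : 0 < t by near: t; exact: nbhs_right_gt.
have t1 : t < 1 by near: t; exact: nbhs_right_lt.
have pE : t *: (xp + w) + (1 - t) *: xp = xp + t *: w.
  by rewrite scalerDr scalerBl scale1r addrC addrA subrK.
have := cg (xp + w) xp t (ltW t0) (ltW t1); rewrite pE guE gxp => g_le.
have := le_trans (min_xp (xp + t *: w)) (leeD2r _ g_le).
rewrite /bpg_model gxp -!EFinM -!EFinD lee_fin /bregman !(dotvC (_ - y)).
rewrite !dotvBr !dotvDr !dotvZr => m_le.
rewrite -(ler_pM2l t0) [leRHS](_ : _ = t * dotv (grad f y) w
  + lam^-1 * (h (xp + t *: w) - h xp - t * dotv (grad h y) w)); last first.
  rewrite mulrDr mulrCA; congr (_ + _ * _).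
  by rewrite mulrBr /q /= [t * (_ / _)]mulrC divfK // gt_eqF.
by move: m_le; lra.
Unshelve. all: by end_near. Qed.

Lemma descent f g h (L mu lam : R) y xp u (gp gu : R) :
  continuously_differentiable f -> econvex g -> kernel_generating h ->
  smooth_adaptable f h L -> relatively_weakly_convex f h mu ->
  0 < lam -> lam <= 1 / L ->
  argmin (bpg_model f g h lam y) xp -> g xp = gp%:E -> g u = gu%:E ->
  f xp + gp + lam^-1 * bregman h u xp
    <= f u + gu + (lam^-1 + mu) * bregman h u y.
Proof.
move=> df cg kh fh fmu lam0 lamL min_xp gxp guE.
have := argmin_model_subgradient cg kh min_xp gxp guE.
have := smooth_adaptable_le xp y df kh fh.
have := relatively_weakly_convex_le u y df kh fmu.
(* Since [L <= 1 / lam], the smoothness error [L D_h(xp, y)] is absorbed. *)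
have : L * bregman h xp y <= lam^-1 * bregman h xp y.
  case: fh => L0 _ _; apply: ler_wpM2r; first exact: bregman_ge0.
  by rewrite -[L]invrK lef_pV2 ?posrE ?invr_gt0 // -div1r.
(* Expansion makes linear the three-point identity [D_h(u, y) = D_h(u, xp) + D_h(xp, y) + <grad h xp
   - grad h y, u - xp>]; the [grad f y] terms cancel in the sum. *)
rewrite dotvBl dotvNl dotvZl dotvBl /bregman !dotvBr.
lra.
Qed.

End descent.

(** * Criticality, semicontinuous limits and bounded sublevel sets *)

Section criticality.
Context {R : realType} {d : nat}.
Implicit Types (u v x y z : 'rV[R]_d) (f h : 'rV[R]_d -> R).
Implicit Types (g : 'rV[R]_d -> \bar R).

Lemma near_grad_remainder f z (e : R) : differentiable f z -> 0 < e ->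
  \forall y \near z, `|f y - f z - dotv (grad f z) (y - z)| <= e * `|y - z|.
Proof.
move=> df e0; have /eqaddoP/(_ e e0) := diff_locally df.
rewrite [X in X -> _](near_shift z); apply: filterS => v /=.
by rewrite sub0r !fctE /= diff_dotv_grad // subrK opprD addrA.
Qed.

(** Zero is already a Fréchet subgradient at [z], so constant sequences suffice: the expansion of
    [f] and the subgradient inequality of [g] bound the quotient below by [- e] near [z]. *)
Lemma crit_objective f g z (gz : R) :
  differentiable f z -> (forall x, g x != -oo%E) -> g z = gz%:E ->
  (forall u gu, g u = gu%:E -> gz + dotv (- grad f z) (u - z) <= gu) ->
  crit (objective f g) z.
Proof.
move=> df gNoo gzE sub_z; have fin_z : objective f g z \is a fin_num.
  by rewrite /objective gzE.
split => //; exists (fun=> z), (fun=> 0); split; try exact: cvg_cst.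
move=> _; split => //; rewrite limf_einfE; apply/lee_subgt0Pr => e e0.
have near_z := nbhs_dnbhs (near_grad_remainder df e0).
rewrite sub0e; apply: le_trans (ereal_sup_ubound _); last by eexists; [exact: near_z|].
apply: le_ereal_inf_tmp => _ [y /= fy <-]; rewrite /objective gzE.
have n0 : 0 <= enorm (y - z) by exact: sqrtr_ge0.
have dot0 : dotv 0 (y - z) = 0 by rewrite dotvC dotv0r.
rewrite dot0 sube0; case gyE : (g y) => [gy| |]; last by have := gNoo y; rewrite gyE.
  rewrite lee_fin.
  have := sub_z _ _ gyE; rewrite dotvNl => gy_ge.
  have : - (e * enorm (y - z)) <= f y + gy - (f z + gz).
    have := ler_wpM2l (ltW e0) (norm_le_enorm (y - z)).
    by move: fy; rewrite ler_norml => /andP[]; lra.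
  move=> num_ge; apply: (@le_trans _ _ (- (e * enorm (y - z)) / enorm (y - z))); last first.
    by apply: ler_wpM2r; rewrite ?invr_ge0.
  rewrite mulNr lerN2 -mulrA ler_piMr ?(ltW e0) //.
  (* The chosen set contains [z] itself, where the convention [0^-1 = 0] makes the quotient
     vanish. *)
  by have [->|?] := eqVneq (enorm (y - z)) 0; rewrite ?mul0r // divff.
apply: (@le_trans _ _ 0%E); first by rewrite lee_fin oppr_le0 ltW.
by rewrite addey // addye // mule_ge0 // lee_fin invr_ge0.
Qed.

(** Every real [a] below [g z] is eventually below [g (x n)], hence below [c n], hence at most
    [l]. *)
Lemma lower_semicontinuous_le_lim g (x : nat -> 'rV[R]_d) z (c : nat -> R) (l : R) :
  lower_semicontinuous g -> x n @[n --> \oo] --> z -> c n @[n --> \oo] --> l ->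
  (\forall n \near \oo, (g (x n) <= (c n)%:E)%E) -> (g z <= l%:E)%E.
Proof.
move=> lsc_g xz cl gc.
suff le_l (a : R) : (a%:E < g z)%E -> a <= l.
  case: (g z) le_l => [r| |] le_l; last by rewrite leNye.
    rewrite lee_fin leNgt; apply/negP => lr.
    have [lt_l lt_r] : l < (l + r) / 2 /\ (l + r) / 2 < r by split; lra.
    by have := le_l _ lt_r; rewrite leNgt lt_l.
  by have := le_l (l + 1) (ltry _); rewrite gerDl ler10.
move=> /lsc_g[V zV aV]; apply: (cvgr_to_ge cl); near=> n.
rewrite -lee_fin; apply: (@le_trans _ _ (g (x n))); last by near: n.
by apply/ltW/aV; near: n; exact: xz.
Unshelve. all: by end_near. Qed.

(** Serves for extrapolation coefficients and inverse step sizes, which are bounded but need not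
    converge. *)
Lemma cvg0_scale (c : nat -> R) (w : nat -> 'rV[R]_d) (C : R) :
  (forall n, `|c n| <= C) -> w n @[n --> \oo] --> (0 : 'rV[R]_d) ->
  c n *: w n @[n --> \oo] --> (0 : 'rV[R]_d).
Proof.
move=> cC /cvgr0Pnorm_le w0; apply/cvgr0Pnorm_le => e e0.
have C0 : 0 <= C by exact: le_trans (cC 0%N).
have := w0 (e / (C + 1)); rewrite divr_gt0 ?ltr_wpDl // => /(_ isT).
apply: filterS => n wn; rewrite normrZ.
apply: (@le_trans _ _ (C * (e / (C + 1)))); first by rewrite ler_pM.
by rewrite mulrA ler_pdivrMr ?ltr_wpDl //; nra.
Qed.

(** Slope 1 gives [enorm u <= phi u] beyond radius [r]; the [0] in the witness covers [enorm u = 0],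
    where the quotient cannot be cleared. *)
Lemma supercoercive_sublevel_bounded (phi : 'rV[R]_d -> \bar R) (B : R) :
  supercoercive phi -> exists M : R, forall u, (phi u <= B%:E)%E -> `|u| <= M.
Proof.
move=> /(_ 1)[r rP]; exists (Num.max 0 (Num.max r B)) => u uB.
apply: le_trans (norm_le_enorm u) _; rewrite !le_max.
have [//|u0] := leP (enorm u) 0; have [//|ru] := leP (enorm u) r.
have := rP _ ru; rewrite lee_pdivlMr // mul1e => /le_trans/(_ uB).
by rewrite lee_fin => ->; rewrite orbT.
Qed.

End criticality.

(** * Real sequences under a perturbed descent inequality *)

Lemma perturbed_descent_cvg (R : realType) (P D : nat -> R) (a b m : R) :
  0 <= a -> b < a -> (forall n, m <= P n) -> (forall n, 0 <= D n) ->
  (forall n, P n.+1 + a * D n.+1 <= P n + b * D n) ->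
  cvgn (series D) /\ cvgn P.
Proof.
move=> a0 ba mP D0 desc; have ab0 : 0 < a - b by rewrite subr_gt0.
(* The Lyapunov function [P n + a * D n] is bounded below and drops by at least [(a - b) * D n] per
   step; telescoping bounds the series. *)
have mH n : m <= P n + a * D n by rewrite -[m]addr0 lerD ?mulr_ge0.
have sum_le n : (a - b) * series D n <= P 0%N + a * D 0%N - (P n + a * D n).
  elim: n => [|n IH]; first by rewrite /series /= big_geq // mulr0 subrr.
  by rewrite seriesSr mulrDr; have := desc n; lra.
have cvgD : cvgn (series D).
  apply: nondecreasing_is_cvgn.
    apply/nondecreasing_seqP => n.
    by rewrite seriesSr lerDl.
  exists ((P 0%N + a * D 0%N - m) / (a - b)) => _ [n _ <-].
  by rewrite ler_pdivlMr // mulrC (le_trans (sum_le n)) // lerB.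
split=> //; have cvgH : cvgn (fun n => P n + a * D n).
  apply: nonincreasing_is_cvgn.
    apply/nonincreasing_seqP => n; have := desc n.
    by have := mulr_ge0 (ltW ab0) (D0 n); lra.
  by exists m => _ [n _ <-].
(* [P] differs from the convergent Lyapunov function by a multiple of [D], which tends to 0 as the
   term of a convergent series. *)
have -> : P = fun n => P n + a * D n - a * D n by apply/funext => n; rewrite addrK.
apply: is_cvgB => //; apply: is_cvgMr.
by apply: cvgP; exact: cvg_series_cvg_0 cvgD.
Qed.

(** Restores the term [D_h(x^{-1}, x^0)], which the shifted descent argument leaves out. *)
Lemma is_cvg_seriesS (R : realType) (D : nat -> R) :
  cvgn (series (fun n => D n.+1)) -> cvgn (series D).
Proof.
move=> cD; apply/cvg_ex; exists (D 0%N + limn (series (fun n => D n.+1))).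
rewrite -cvg_shiftS /=.
rewrite (_ : (fun n => _) = fun n => D 0%N + series (fun n => D n.+1) n); last first.
  by apply/funext => n; rewrite /series /= big_nat_recl.
by apply: cvgD => //; exact: cvg_cst.
Qed.

(** * Descent and boundedness of the BPGe iterates *)

Section bpge_convergence.
Context {R : realType} {d : nat}.
Context (f h : 'rV[R]_d -> R) (g : 'rV[R]_d -> \bar R).
Context (L mu eta betahat rho : R) (lambda : nat -> R).
Context (x0 : 'rV[R]_d) (x : nat -> 'rV[R]_d).
Implicit Types z : 'rV[R]_d.
Let Psi := objective f g.
Context (f_C1 : continuously_differentiable f).
Context (g_proper : eproper g).
Context (g_lsc : lower_semicontinuous g).
Context (g_convex : econvex g).
Context (Psi_inf : (-oo < ereal_inf (range Psi))%E).
Context (h_kernel : kernel_generating h).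
Context (fh_smad : smooth_adaptable f h L).
Context (mu_ge0 : 0 <= mu).
Context (f_weakly_convex : relatively_weakly_convex f h mu).
Context (Psi_supercoercive : supercoercive Psi).
Context (h_cvg_converse : forall (u v : nat -> 'rV[R]_d) (vstar : 'rV[R]_d),
  v k @[k --> \oo] --> vstar -> bounded_fun u ->
  bregman h (u k) (v k) @[k --> \oo] --> (0 : R) ->
  u k @[k --> \oo] --> vstar).
Context (eta_gt0 : 0 < eta).
Context (eta_lt1 : eta < 1).
Context (betahat_ge0 : 0 <= betahat).
Context (betahat_lt1 : betahat < 1).
Context (rho_gt0 : 0 < rho).
Context (lambda_gt0 : forall k, 0 < lambda k).
Context (lambda_le : forall k, lambda k <= 1 / L).
Context (lambda_inf_gt0 : 0 < inf (range lambda)).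
Context (rho_lt : rho < inf (range lambda) / sup (range lambda)).
Context (x_bpge : bpge f g h mu eta betahat rho lambda x0 x).

Let D k := bregman h (x k) (x k.+1).
(** The shift avoids [x 0], where [g] may be [+oo]; every later iterate is a minimizer, so [fine]
    loses nothing. *)
Let gr k := fine (g (x k.+1)).
Let P k := f (x k.+1) + gr k.

(** The denominator of [C_k] cancels the coefficient [1 / lambda k + mu] of the descent
    inequality. *)
Lemma bpge_step k : exists b : R, let y := extrapolate b (x k.-1) (x k) in
  [/\ 0 <= b <= 1,
      (lambda k)^-1 * bregman h (x k) y + mu * bregman h (x k) y
        <= rho / lambda k * bregman h (x k.-1) (x k) &
      argmin (bpg_model f g h (lambda k) y) (x k.+1)].
Proof.
have [_ /(_ k)[j /= [ok _ xmin]]] := x_bpge.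
have e0 : 0 <= eta ^+ j by rewrite exprn_ge0 // ltW.
have e1 : eta ^+ j <= 1 by rewrite exprn_ile1 // ltW.
exists (eta ^+ j * betahat); split=> //.
  by rewrite mulr_ge0 // mulr_ile1 // ltW.
move: ok; rewrite /linesearch_ok => ok.
have lmu : 0 < (lambda k)^-1 + mu by rewrite ltr_wpDr // invr_gt0.
have := ler_wpM2l (ltW lmu) ok; rewrite -mulrDl => /le_trans; apply.
rewrite le_eqVlt; apply/orP; left; apply/eqP.
rewrite mulrA mulrCA [_ * (_ / _)]mulrC divfK ?gt_eqF //.
Qed.

Lemma x_fin k : g (x k.+1) = (gr k)%:E.
Proof.
have [b [_ _ xmin]] := bpge_step k.
by rewrite /gr fineK //; exact: argmin_model_fin_num xmin.
Qed.

Lemma lambda_inf_le k : inf (range lambda) <= lambda k.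
Proof. by apply: ge_inf; [exists 0 => _ [n _ <-]; exact: ltW|exists k]. Qed.

Lemma lambda_le_sup k : lambda k <= sup (range lambda).
Proof. by apply: ub_le_sup; [exists (1 / L) => _ [n _ <-]|exists k]. Qed.

(** [descent] at step [k.+1] with [u = x k.+1]; the infimum and supremum of the steps make both
    coefficients independent of [k]. *)
Lemma bpge_descent k :
  P k.+1 + (sup (range lambda))^-1 * D k.+1
    <= P k + rho / inf (range lambda) * D k.
Proof.
have [b [_ yD xmin]] := bpge_step k.+1.
have := descent f_C1 g_convex h_kernel fh_smad f_weakly_convex (lambda_gt0 _)
  (lambda_le _) xmin (x_fin k.+1) (x_fin k).
have D0 n : 0 <= D n by exact: bregman_ge0.
have sup0 : 0 < sup (range lambda) by exact: lt_le_trans (lambda_le_sup 0%N).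
have : (sup (range lambda))^-1 * D k.+1 <= (lambda k.+1)^-1 * D k.+1.
  by rewrite ler_wpM2r // lef_pV2 ?posrE // lambda_le_sup.
have : rho / lambda k.+1 * D k <= rho / inf (range lambda) * D k.
  by rewrite ler_wpM2r // ler_pM2l // lef_pV2 ?posrE // lambda_inf_le.
move: yD; rewrite /P /D /= mulrDl; lra.
Qed.

Lemma Psi_shift k : Psi (x k.+1) = (P k)%:E.
Proof. by rewrite /Psi /objective x_fin. Qed.

Lemma bpge_cvg : cvgn (series D) /\ cvgn P.
Proof.
have [m mP] : exists m : R, forall u, (m%:E <= Psi u)%E.
  have := Psi_inf; case E : (ereal_inf _) => [m| |] // _; [exists m|exists 0] => u.
    by rewrite -E; apply: ereal_inf_lbound; exists u.
  apply: (@le_trans _ _ +oo%E); first by rewrite leey.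
  by rewrite -E; apply: ereal_inf_lbound; exists u.
have sup0 : 0 < sup (range lambda) by exact: lt_le_trans (lambda_le_sup 0%N).
apply: (perturbed_descent_cvg _ _ _ _ bpge_descent (m := m)).
- by rewrite invr_ge0 ltW.
(* The bound on [rho] is exactly [rho / inf < 1 / sup]. *)
- by rewrite ltr_pdivrMr // mulrC.
- by move=> n; rewrite -lee_fin -Psi_shift.
- by move=> n; exact: bregman_ge0.
Qed.

Lemma cvg_D : D k @[k --> \oo] --> (0 : R).
Proof. by have [/cvg_series_cvg_0] := bpge_cvg. Qed.

(** A convergent [P] is bounded, so all iterates after [x 0] lie in one sublevel set of [Psi]. *)
Lemma bounded_fun_bpge (j : nat -> nat) : bounded_fun (fun n => x (j n)).
Proof.
have [_ /cvg_seq_bounded/pinfty_ex_gt0[B _ PB]] := bpge_cvg.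
have [M xM] := supercoercive_sublevel_bounded B Psi_supercoercive.
have x_le k : `|x k| <= Num.max `|x 0%N| M.
  case: k => [|k]; first by rewrite le_max lexx.
  rewrite le_max xM ?orbT // Psi_shift lee_fin.
  by rewrite (le_trans (ler_norm _)) //; exact: PB.
exists (Num.max `|x 0%N| M); split; first exact: num_real.
by move=> C /ltW MC n _ /=; exact: le_trans MC.
Qed.

(** * Limit points of the iterates *)

Lemma omega_limit_indices z : omega_limit x z -> exists2 j : nat -> nat,
  j n @[n --> \oo] --> \oo & x (j n).+2 @[n --> \oo] --> z.
Proof.
move=> [s s_incr xs].
have le_s n : (n <= s n)%N.
  elim: n => // n /leq_ltn_trans; apply.
  by move/increasing_seqP : s_incr => /(_ n).
have sE n : (s n.+2).-2.+2 = s n.+2.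
  by have := le_s n.+2; case: (s n.+2) => [|[]].
(* Since [s n.+2 >= 2], no truncation occurs, and the two preceding iterates have indices [j n] and
   [(j n).+1]. *)
exists (fun n => (s n.+2).-2).
  apply/cvgnyPge => N; exists N => // n /= Nn.
  by rewrite -2!ltnS sE (leq_trans _ (le_s _)).
under eq_fun do rewrite sE.
by move: xs; rewrite -cvg_shiftS -cvg_shiftS.
Unshelve. all: by end_near. Qed.

(** Boundedness and [D_h(x^k, x^{k+1}) -> 0] let the converse property of [h] pass the limit back
    one index. *)
Lemma cvg_bpge_pred (j : nat -> nat) z : j n @[n --> \oo] --> \oo ->
  x (j n).+1 @[n --> \oo] --> z -> x (j n) @[n --> \oo] --> z.
Proof.
move=> jy xz; apply: (h_cvg_converse xz); first exact: bounded_fun_bpge.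
exact: cvg_comp jy cvg_D.
Qed.

Lemma omega_limit_crit z (zeta : R) : P k @[k --> \oo] --> zeta ->
  omega_limit x z -> crit Psi z /\ Psi z = zeta%:E.
Proof.
move=> Pzeta /omega_limit_indices[j jy x2z].
have jSy : (j n).+1 @[n --> \oo] --> \oo.
  rewrite (_ : (fun n => _) = (fun m => m + 1)%N \o j).
    exact: cvg_comp jy (cvg_addnr 1).
  by apply/funext => n /=; rewrite addn1.
have x1z : x (j n).+1 @[n --> \oo] --> z by exact: (@cvg_bpge_pred (S \o j)).
have x0z := cvg_bpge_pred jy x1z.
have [b bP] := choice (fun n => bpge_step (j n).+1).
pose y n := extrapolate (b n) (x (j n)) (x (j n).+1).
have yz : y n @[n --> \oo] --> z.
  rewrite -[z]addr0; apply: cvgD => //; apply: (@cvg0_scale _ _ _ _ 1).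
    by move=> n; have [/andP[b0 b1] _ _] := bP n; rewrite ger0_norm.
  by rewrite -(subrr z); exact: cvgB.
have xmin n : argmin (bpg_model f g h (lambda (j n).+1) (y n)) (x (j n).+2).
  by have [] := bP n.
have [df cf] := f_C1; have [_ [_ ch]] := h_kernel.
(* A subgradient of [g] at [x (j n).+2]. Its second term vanishes in the limit: inverse steps are
   bounded and both gradients of [h] tend to [grad h z]. *)
pose v n := - grad f (y n)
  - (lambda (j n).+1)^-1 *: (grad h (x (j n).+2) - grad h (y n)).
have vz : v n @[n --> \oo] --> - grad f z.
  rewrite -[- grad f z]subr0; apply: cvgB.
    by apply: cvgN; exact: continuous_cvg (cf z) yz.
  apply: (@cvg0_scale _ _ _ _ (inf (range lambda))^-1) => [n|].
    by rewrite gtr0_norm ?invr_gt0 // lef_pV2 ?posrE // lambda_inf_le.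
  rewrite -(subrr (grad h z)).
  by apply: cvgB; [exact: continuous_cvg (ch z) x2z|exact: continuous_cvg (ch z) yz].
have cvg_vdot u : dotv (v n) (u - x (j n).+2) @[n --> \oo] --> dotv (- grad f z) (u - z).
  by apply: cvg_dotv vz _; apply: cvgB => //; exact: cvg_cst.
have gr_zeta : gr (j n).+1 @[n --> \oo] --> zeta - f z.
  have -> : (fun n => gr (j n).+1) = fun n => P (j n).+1 - f (x (j n).+2).
    by apply/funext => n; rewrite /P addrAC subrr add0r.
  apply: cvgB; first exact: cvg_comp jSy Pzeta.
  by apply: continuous_cvg x2z; exact: differentiable_continuous.
(* The limit of the subgradient inequalities, with [zeta - f z] not yet identified with [g z]. *)
have sub_lim u gu : g u = gu%:E -> zeta - f z + dotv (- grad f z) (u - z) <= gu.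
  move=> guE; apply: (cvgr_to_le (cvgD gr_zeta (cvg_vdot u))); near=> n.
  exact: argmin_model_subgradient (xmin n) (x_fin _) guE.
have gz_le : (g z <= (zeta - f z)%:E)%E.
  by apply: lower_semicontinuous_le_lim x2z gr_zeta _ => //; near=> n; rewrite x_fin.
have gNoo := g_proper.1; case gzE : (g z) => [gz| |]; last by have := gNoo z; rewrite gzE.
(* Lower semicontinuity gives [<=]; [sub_lim] at [u = z] gives [>=]. *)
- have gz_zeta : gz = zeta - f z.
    apply/eqP; rewrite eq_le -lee_fin -gzE gz_le /=.
    by have := sub_lim _ _ gzE; rewrite subrr dotv0r addr0.
  split; last by rewrite /Psi /objective gzE gz_zeta -EFinD addrC subrK.
  by apply: crit_objective gzE _ => //; rewrite gz_zeta.
- by move: gz_le; rewrite gzE.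
Unshelve. all: by end_near. Qed.

Lemma bpge_limits :
  [/\ cvgn (series (fun k => bregman h (x k.-1) (x k))) /\
      bregman h (x k.-1) (x k) @[k --> \oo] --> (0 : R),
      omega_limit x `<=` crit Psi &
      exists zeta : R,
        Psi (x k) @[k --> \oo] --> zeta%:E /\
        forall z, omega_limit x z -> Psi z = zeta%:E].
Proof.
have [cD cP] := bpge_cvg.
have cD' : cvgn (series (fun k => bregman h (x k.-1) (x k))) by exact: is_cvg_seriesS.
split; first by split=> //; exact: cvg_series_cvg_0.
  by move=> z /(omega_limit_crit cP)[].
exists (limn P); split=> [|z /(omega_limit_crit cP)[]//].
(* Dropping the first term discards [Psi (x 0)], possibly [+oo]. *)
rewrite -cvg_shiftS (_ : [sequence _]_n = EFin \o P); first exact/cvg_EFin/cP/nearW.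
by apply/funext => n; exact: Psi_shift.
Qed.
End bpge_convergence.

Theorem lemma2 (R : realType) (d : nat)
    (f h : 'rV[R]_d -> R) (g : 'rV[R]_d -> \bar R)
    (L mu eta betahat rho : R) (lambda : nat -> R)
    (x0 : 'rV[R]_d) (x : nat -> 'rV[R]_d)
    (Psi := objective f g)
    (f_C1 : continuously_differentiable f)
    (g_proper : eproper g)
    (g_lsc : lower_semicontinuous g)
    (g_convex : econvex g)
    (Psi_inf : (-oo < ereal_inf (range Psi))%E)
    (h_kernel : kernel_generating h)
    (fh_smad : smooth_adaptable f h L)
    (mu_ge0 : 0 <= mu) (mu_leL : mu <= L)
    (f_weakly_convex : relatively_weakly_convex f h mu)
    (Psi_supercoercive : supercoercive Psi)
    (h_strictly_convex : strictly_convex h)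
    (h_cvg : forall (u : nat -> 'rV[R]_d) (ustar : 'rV[R]_d),
      u k @[k --> \oo] --> ustar ->
      bregman h ustar (u k) @[k --> \oo] --> (0 : R))
    (h_cvg_converse : forall (u v : nat -> 'rV[R]_d) (vstar : 'rV[R]_d),
      v k @[k --> \oo] --> vstar -> bounded_fun u ->
      bregman h (u k) (v k) @[k --> \oo] --> (0 : R) ->
      u k @[k --> \oo] --> vstar)
    (eta_gt0 : 0 < eta) (eta_lt1 : eta < 1)
    (betahat_ge0 : 0 <= betahat) (betahat_lt1 : betahat < 1)
    (rho_gt0 : 0 < rho) (rho_lt1 : rho < 1)
    (lambda_gt0 : forall k, 0 < lambda k)
    (lambda_le : forall k, lambda k <= 1 / L)
    (lambda_inf_gt0 : 0 < inf (range lambda))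
    (rho_lt : rho < inf (range lambda) / sup (range lambda))
    (x_bpge : bpge f g h mu eta betahat rho lambda x0 x) :
  [/\ cvgn (series (fun k => bregman h (x k.-1) (x k))) /\
      bregman h (x k.-1) (x k) @[k --> \oo] --> (0 : R),
      omega_limit x `<=` crit Psi &
      exists zeta : R,
        Psi (x k) @[k --> \oo] --> zeta%:E /\
        forall z, omega_limit x z -> Psi z = zeta%:E].
Proof.
exact: (bpge_limits f_C1 g_proper g_lsc g_convex Psi_inf h_kernel fh_smad mu_ge0
  f_weakly_convex Psi_supercoercive h_cvg_converse eta_gt0 eta_lt1 betahat_ge0
  betahat_lt1 rho_gt0 lambda_gt0 lambda_le lambda_inf_gt0 rho_lt x_bpge).
Qed.
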